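(* There exists an absolute constant $C>0$ such that the following holds. Let $\mathfrak{X}=(\Omega,S)$ be a scheme on $n=|\Omega|$ points, and let $a\in S^\cup$ be a connected relation. Then \[ \overrightarrow{\mathrm{diam}}(a) \leq C\cdot \mathrm{diam}(a)^2(\log n)^2, \] i.e. $\overrightarrow{\mathrm{diam}}(a)=O(\mathrm{diam}(a)^2(\log n)^2)$.
   Context: Let $\Omega$ be a finite set. For a relation $a\subseteq\Omega\times\Omega$ write $a^*=\{(\beta,\alpha)\mid(\alpha,\beta)\in a\}$, and let $1_\Omega=\{(\alpha,\alpha)\mid\alpha\in\Omega\}$. A scheme (homogeneous coherent configuration) is a pair $\mathfrak{X}=(\Omega,S)$ where $S$ is a partition of $\Omega\times\Omega$ into relations such that: (1) $1_\Omega\in S$; (2) if $a\in S$ then $a^*\in S$; (3) for any $a,b,c\in S$ the number $|\{\gamma\in\Omega\mid(\alpha,\gamma)\in b,\ (\gamma,\beta)\in c\}|$ does not depend on the choice of $(\alpha,\beta)\in a$. $S^\cup$ denotes the set of all unions of relations from $S$. Relations on $\Omega$ are viewed as directed graphs on the vertex set $\Omega$. The directed diameter $\overrightarrow{\mathrm{diam}}(a)$ is the maximum over ordered pairs of vertices of the length of a shortest path respecting edge orientations; the undirected diameter is $\mathrm{diam}(a)=\overrightarrow{\mathrm{diam}}(a\cup a^* )$. Connected means that any two vertices are joined by a path ignoring orientations; for $a\in S^\cup$ this is equivalent to strong connectivity, so the directed diameter is finite. $\log$ is the base-2 logarithm. *)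

(* Defs.v *)
From HB Require Import structures.
From mathcomp Require Import all_boot all_order all_algebra.
From mathcomp Require Import classical_sets reals constructive_ereal ereal exp.

Set Implicit Arguments.
Unset Strict Implicit.
Unset Printing Implicit Defensive.

Import Order.TTheory GRing.Theory Num.Theory.
Local Open Scope ring_scope.

Section Schemes.
Variable Omega : finType.
Implicit Types (a b c : {set Omega * Omega}) (S : {set {set Omega * Omega}}).

Definition diag_rel : {set Omega * Omega} := [set z | z.1 == z.2].

Definition conv_rel a : {set Omega * Omega} := [set z | (z.2, z.1) \in a].

Definition n_between b c (x y : Omega) : nat :=
  #|[set z | ((x, z) \in b) && ((z, y) \in c)]|.

(* [finset.partition] excludes empty blocks, so the second clause forces
   [Omega] to be nonempty. *)
Definition is_scheme S : Prop :=
  [/\ finset.partition S [set: Omega * Omega],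
      diag_rel \in S,
      forall a, a \in S -> conv_rel a \in S
    & forall a b c, a \in S -> b \in S -> c \in S ->
        forall x y x' y', (x, y) \in a -> (x', y') \in a ->
          n_between b c x y = n_between b c x' y'].

Definition is_union_of S a : Prop :=
  exists2 T : {set {set Omega * Omega}}, T \subset S & a = finset.cover T.

Definition edge a : rel Omega := fun x y => (x, y) \in a.

Definition connected_rel a : Prop :=
  forall x y, connect (edge (a :|: conv_rel a)) x y.

Section Diameter.
Variable R : realType.

(* The infimum is over all directed walks [x :: p] from [x] to [y];
   it is [+oo] when there are none. *)
Definition dist a (x y : Omega) : \bar R :=
  ereal_inf [set ((size p)%:R)%:E |
              p in [set p : seq Omega | path (edge a) x p /\ last x p = y]]%classic.

Definition ddiam a : \bar R := \big[maxe/0%E]_(z : Omega * Omega) dist a z.1 z.2.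

Definition diam a : \bar R := ddiam (a :|: conv_rel a).

End Diameter.
End Schemes.

Definition log2 (R : realType) (x : R) : R := ln x / ln 2.

(* Main.v *)
(* Fix a set [A] of points and consider, for a cell [c] of the scheme, the
   proportion f(c) of the pairs of [c] leading from [A] to its complement.
   Coherence gives f(c) <= f(b) + f(s) whenever [c] occurs in the product of
   [b] and [s], so along walks in the undirected graph f(c) is at most diam(a)
   times the largest f(s), [s] a cell of a or a^*.  Valency counting gives
   f(s^* ) = f(s), and f(s) <= |N^+(A) - A| / n for s in a.  Summing over all
   cells, |A| <= 2 diam(a) |N^+(A) - A| as soon as 2|A| <= n.  Hence directed
   balls double every 2 diam(a) steps until they exceed n/2, and an out-ball
   and an in-ball of radius 2 diam(a) log n meet: the directed diameter is in
   fact at most 4 diam(a) log n. *)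
Require Import Defs.
From mathcomp Require Import all_boot all_order all_algebra.
From mathcomp Require Import reals constructive_ereal ereal exp.
From mathcomp Require Import zify.

Set Implicit Arguments.
Unset Strict Implicit.
Unset Printing Implicit Defensive.

Import Order.TTheory GRing.Theory Num.Theory.

(** * Weighted counts of pairs and triangles *)

Section Cuts.
Variable Omega : finType.
Implicit Types (a b c s : {set Omega * Omega}) (A : {set Omega}).

(** The free weight lets one count of triangles yield both sizes of cells (weight 1) and cuts
    (weight [leaves A]). *)
Definition weight_sum s (w : Omega -> Omega -> nat) : nat :=
  \sum_x \sum_y ((x, y) \in s) * w x y.

Definition leaves A (x y : Omega) : bool := (x \in A) && (y \notin A).

Definition cut A s : nat := weight_sum s (leaves A).

Definition out_nbr a A : {set Omega} := [set y | [exists x in A, (x, y) \in a]].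

Lemma weight_sum_card s : weight_sum s (fun _ _ => 1) = #|s|.
Proof.
rewrite /weight_sum pair_bigA /= -sum1_card [RHS]big_mkcond /=.
by apply: eq_bigr => -[x y] _ /=; rewrite muln1; case: ifP.
Qed.

Lemma n_betweenE b c x y :
  n_between b c x y = \sum_z ((x, z) \in b) * ((z, y) \in c).
Proof.
rewrite /n_between -sum1dep_card big_mkcond /=.
by apply: eq_bigr => z _; rewrite mulnb; case: ifP.
Qed.

Lemma triangle_sum c b s w p :
    (forall x y, (x, y) \in c -> n_between b s x y = p) ->
  \sum_x \sum_y \sum_z
     ((x, y) \in c) * ((x, z) \in b) * ((z, y) \in s) * w x y
  = p * weight_sum c w.
Proof.
move=> pE; rewrite big_distrr /=; apply: eq_bigr => x _.
rewrite big_distrr /=; apply: eq_bigr => y _.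
case: (boolP ((x, y) \in c)) => [xyc|_]; last by rewrite big1 ?mul0n ?muln0.
rewrite -(pE _ _ xyc) n_betweenE mul1n big_distrl /=.
by apply: eq_bigr => z _; rewrite mul1n.
Qed.

Lemma conv_relK : involutive (@conv_rel Omega).
Proof. by move=> c; apply/setP=> -[x y]; rewrite !inE. Qed.

(** * Intersection numbers, valencies and cuts in a scheme *)

Section InScheme.
Variable S : {set {set Omega * Omega}}.
Hypothesis schS : is_scheme S.

Let partS : finset.partition S [set: Omega * Omega].
Proof. by case: schS. Qed.

Let diagS : diag_rel Omega \in S.
Proof. by case: schS. Qed.

Let convS c : c \in S -> conv_rel c \in S.
Proof. by case: schS => _ _ + _; apply. Qed.

Lemma scheme_points_gt0 : 0 < #|Omega|.
Proof.
case/and3P: partS => _ _; apply: contraNT; rewrite -eqn0Ngt => /eqP/card0_eq O0.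
suff <- : diag_rel Omega = set0 by exact: diagS.
by apply/setP=> -[x y]; have := O0 x; rewrite inE.
Qed.

Lemma cell_of z : exists2 c, c \in S & z \in c.
Proof.
have : z \in finset.cover S by rewrite (cover_partition partS) inE.
by case/bigcupP=> c cS zc; exists c.
Qed.

Lemma cell_eq c1 c2 z : c1 \in S -> c2 \in S -> z \in c1 -> z \in c2 -> c1 = c2.
Proof.
case/and3P: partS => _ tS _ c1S c2S zc1 zc2.
by rewrite -(def_pblock tS c1S zc1) (def_pblock tS c2S zc2).
Qed.

Lemma n_between_const c b s : c \in S -> b \in S -> s \in S ->
  exists p, forall x y, (x, y) \in c -> n_between b s x y = p.
Proof.
move=> cS bS sS.
have [[x0 y0] xyc|c0] := pickP [in c]; last first.
  by exists 0 => x y xyc; have := c0 (x, y); rewrite /= xyc.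
exists (n_between b s x0 y0) => x y xyc'.
by case: schS => _ _ _; apply; [exact: cS| | | |].
Qed.

(** Out- and in-degrees are intersection numbers of the diagonal cell, hence constant; summed over
    all points both give [#|s|], so they agree. *)
Lemma valency s : s \in S ->
  exists k, (forall x, \sum_y ((x, y) \in s) = k) /\
            (forall y, \sum_x ((x, y) \in s) = k).
Proof.
move=> sS; have dS := diagS; have csS := convS sS.
have outnE x : n_between s (conv_rel s) x x = \sum_y ((x, y) \in s).
  by rewrite n_betweenE; apply: eq_bigr => y _; rewrite inE /=; case: (_ \in s).
have innE x : n_between (conv_rel s) s x x = \sum_y ((y, x) \in s).
  by rewrite n_betweenE; apply: eq_bigr => y _; rewrite inE /=; case: (_ \in s).
have [k kE] := n_between_const dS sS csS.
have [l lE] := n_between_const dS csS sS.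
have koE x : \sum_y ((x, y) \in s) = k by rewrite -outnE kE // inE.
have liE x : \sum_y ((y, x) \in s) = l by rewrite -innE lE // inE.
suff [/card0_eq O0|kl] : #|Omega| = 0 \/ k = l.
- by exists 0; split=> x; have := O0 x; rewrite inE.
- by exists k; split=> // x; rewrite liE.
have : \sum_(x : Omega) k = \sum_(x : Omega) l.
  rewrite -(eq_bigr _ (fun x _ => koE x)) exchange_big /=.
  exact: (eq_bigr _ (fun x _ => liE x)).
by rewrite !sum_nat_const => /eqP; rewrite eqn_mul2l => /orP[] /eqP; [left|right].
Qed.

(* All edges of a given cell lie in the same number of triangles of a given
   type, so the proportion of edges leaving [A] satisfies a triangle
   inequality, stated without division: the proportions are bounded by
   [m / M] for [b], [i * m / M] for [s] and [(i + 1) * m / M] for [c]. *)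
Lemma cut_triangle A c b s M m i x y z :
    c \in S -> b \in S -> s \in S ->
    (x, y) \in c -> (x, z) \in b -> (z, y) \in s ->
    cut A b * M <= m * #|b| -> cut A s * M <= i * m * #|s| ->
  cut A c * M <= i.+1 * m * #|c|.
Proof.
move=> cS bS sS xyc xzb zys leb les.
(* [p], [q], [r] count the same triangles [x], [z], [y] over a fixed side in [c], [b], [s]
   respectively. *)
have [p pE] := n_between_const cS bS sS.
have [q qE] := n_between_const bS cS (convS sS).
have [r rE] := n_between_const sS (convS bS) cS.
have p_gt0 : 0 < p.
  by rewrite -(pE _ _ xyc); apply/card_gt0P; exists z; rewrite inE xzb.
have pT w := triangle_sum w pE.
have qT w : \sum_x \sum_y \sum_z
    ((x, y) \in c) * ((x, z) \in b) * ((z, y) \in s) * w x z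
    = q * weight_sum b w.
  rewrite -(triangle_sum w qE); apply: eq_bigr => x' _.
  rewrite exchange_big /=; apply: eq_bigr => z' _; apply: eq_bigr => y' _.
  by rewrite inE /= (mulnC ((x', y') \in c)).
have rT w : \sum_x \sum_y \sum_z
    ((x, y) \in c) * ((x, z) \in b) * ((z, y) \in s) * w z y
    = r * weight_sum s w.
  rewrite -(triangle_sum w rE) exchange_big /= [RHS]exchange_big /=.
  apply: eq_bigr => y' _.
  rewrite exchange_big /=; apply: eq_bigr => z' _; apply: eq_bigr => x' _.
  by rewrite inE /=; congr muln; rewrite mulnC mulnA mulnAC.
have pq : p * #|c| = q * #|b| by rewrite -!weight_sum_card -pT -qT.
have pr : p * #|c| = r * #|s| by rewrite -!weight_sum_card -pT -rT.
(* If [(x, y)] leaves [A], then [(x, z)] does when [z] is outside [A], and [(z, y)] does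
   otherwise. *)
have cut_le : p * cut A c <= q * cut A b + r * cut A s.
  rewrite -pT -qT -rT -big_split; apply: leq_sum => x' _ /=.
  rewrite -big_split; apply: leq_sum => y' _ /=.
  rewrite -big_split; apply: leq_sum => z' _ /=.
  rewrite -mulnDr leq_mul2l; apply/orP; right.
  by rewrite /leaves; case: (x' \in A); case: (y' \in A); case: (z' \in A).
rewrite -(leq_pmul2l p_gt0).
have h1 : q * (cut A b * M) <= q * (m * #|b|) by rewrite leq_mul2l leb orbT.
have h2 : r * (cut A s * M) <= r * (i * m * #|s|) by rewrite leq_mul2l les orbT.
have h3 : p * cut A c * M <= (q * cut A b + r * cut A s) * M.
  by rewrite leq_mul2r cut_le orbT.
rewrite mulnA; apply: leq_trans h3 _; rewrite mulnDl -2!mulnA.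
apply: leq_trans (leq_add h1 h2) _.
by rewrite (mulnCA q) -pq (mulnCA r) -pr (mulnCA p) mulSn mulnDl.
Qed.

(** With [k] the valency, [k * #|A|] pairs of [s] start in [A] and as many end in [A]; discarding
    those inside [A] leaves equally many going out and coming in. *)
Lemma cut_conv A s : s \in S -> cut A (conv_rel s) = cut A s.
Proof.
case/valency=> k [outk ink].
pose I := \sum_(x in A) \sum_(y in A) ((x, y) \in s).
have cutE : cut A s + I = k * #|A|.
  rewrite mulnC -sum_nat_const /cut /weight_sum /I.
  rewrite [X in _ + X]big_mkcond [RHS]big_mkcond -big_split.
  apply: eq_bigr => x _ /=; case: ifP => xA; last first.
    by rewrite addn0 big1 // => y _; rewrite /leaves xA muln0.
  rewrite -(outk x) [X in _ + X]big_mkcond -big_split; apply: eq_bigr => y _ /=.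
  by rewrite /leaves xA; case: (y \in A); rewrite /= ?muln0 ?muln1 ?addn0.
have cutcE : cut A (conv_rel s) + I = k * #|A|.
  rewrite mulnC -sum_nat_const /cut /weight_sum /I exchange_big /= exchange_big /=.
  rewrite [X in _ + X]exchange_big /=.
  rewrite [X in _ + X]big_mkcond [RHS]big_mkcond -big_split.
  apply: eq_bigr => x _ /=; case: ifP => xA; last first.
    by rewrite addn0 big1 // => y _; rewrite /leaves xA muln0.
  rewrite -(ink x) [X in _ + X]big_mkcond -big_split; apply: eq_bigr => y _ /=.
  by rewrite /leaves inE xA; case: (y \in A); rewrite /= ?muln0 ?muln1 ?addn0.
lia.
Qed.

(** Pairs of [s] leaving [A] end in the boundary, where every point has in-degree [k], while [#|s|]
    is [k] times the number of points. *)
Lemma cut_le_boundary A a s : s \in S -> s \subset a ->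
  cut A s * #|Omega| <= #|out_nbr a A :\: A| * #|s|.
Proof.
move=> sS sa; have [k [outk ink]] := valency sS.
have -> : #|s| = #|Omega| * k.
  rewrite -weight_sum_card -sum_nat_const; apply: eq_bigr => x _.
  by rewrite -(outk x); apply: eq_bigr => y _; rewrite muln1.
suff : cut A s <= #|out_nbr a A :\: A| * k by nia.
rewrite -sum_nat_const /cut /weight_sum exchange_big [leqRHS]big_mkcond /=.
apply: leq_sum => y _; case: ifP => [_|ynb].
  rewrite -(ink y); apply: leq_sum => x _.
  by case: (_ \in s); case: (leaves _ _ _).
rewrite big1 // => x _; case: (boolP ((x, y) \in s)) => // xys.
rewrite mul1n /leaves; case: (boolP (x \in A)) => //= xA.
case: (boolP (y \in A)) => //= yA; move: ynb; rewrite !inE yA /=.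
by move/existsP=> []; exists x; rewrite xA (subsetP sa).
Qed.

(** * Expansion of unions of cells *)

Lemma cell_in_union a z : is_union_of S a -> z \in a ->
  exists c, [/\ c \in S, z \in c & c \subset a].
Proof.
case=> T TS -> /bigcupP[c cT zc]; exists c; split=> //; last exact: bigcup_sup.
exact: (subsetP TS).
Qed.

Lemma conv_union a : is_union_of S a -> is_union_of S (conv_rel a).
Proof.
case=> T TS ->; exists [set conv_rel c | c in T].
  by apply/subsetP=> _ /imsetP[c cT ->]; apply/convS/(subsetP TS).
apply/setP=> -[x y]; rewrite inE /=; apply/bigcupP/bigcupP => -[c cT xyc].
  by exists (conv_rel c); rewrite ?imset_f // inE.
by case/imsetP: cT xyc => {}c cT -> ; rewrite inE; exists c.
Qed.

(** Induction along the walk: split off the first edge, which lies in a cell inside [a] or in the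
    converse of one, and apply [cut_triangle]. *)
Lemma cut_walk A a c x p : is_union_of S a ->
    path (edge (a :|: conv_rel a)) x p -> c \in S -> (x, last x p) \in c ->
  cut A c * #|Omega| <= size p * #|out_nbr a A :\: A| * #|c|.
Proof.
move=> ua; elim: p x c => [|z p IHp] x c /= => [_ cS xxc|/andP[xz zp] cS xyc].
  (* An empty walk forces [c] to be the diagonal, none of whose pairs leaves [A]. *)
  rewrite (cell_eq cS diagS xxc) ?inE // /cut /weight_sum big1 // => y _.
  rewrite big1 // => z _; rewrite inE /leaves /=.
  by case: eqP => // ->; rewrite andbN.
have [b bS zyb] := cell_of (z, last z p).
suff [s [sS xzs les]] : exists s, [/\ s \in S, (x, z) \in s &
    cut A s * #|Omega| <= #|out_nbr a A :\: A| * #|s|].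
  exact: cut_triangle xyc xzs zyb les (IHp _ _ zp bS zyb).
move: xz; rewrite /edge !inE /= => /orP[] /(cell_in_union ua)[s [sS xzs sa]].
  by exists s; split=> //; apply: cut_le_boundary.
exists (conv_rel s); split; [exact: convS|by rewrite inE|].
rewrite cut_conv //.
have -> : #|conv_rel s| = #|s|.
  rewrite -!weight_sum_card /weight_sum exchange_big.
  by apply: eq_bigr => y _; apply: eq_bigr => y' _; rewrite inE.
exact: cut_le_boundary.
Qed.

Lemma expansion A a D : is_union_of S a ->
    (forall x y, exists p, [/\ path (edge (a :|: conv_rel a)) x p,
                               last x p = y & size p <= D]) ->
    #|A|.*2 <= #|Omega| ->
  #|A| <= D.*2 * #|out_nbr a A :\: A|.
Proof.
move=> ua walks Ahalf; set m := #|out_nbr a A :\: A|.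
have cut_cell c : c \in S -> cut A c * #|Omega| <= D * m * #|c|.
  move=> cS; have [[x y] xyc|c0] := pickP [in c]; last first.
    suff -> : cut A c = 0 by [].
    rewrite /cut /weight_sum big1 // => x _; rewrite big1 // => y _.
    by have := c0 (x, y); rewrite /= => ->.
  have [p [xp xpy pD]] := walks x y.
  have xyc' : (x, last x p) \in c by rewrite xpy.
  apply: leq_trans (cut_walk A ua xp cS xyc') _.
  by rewrite !leq_mul2r pD !orbT.
(* The cells partition all pairs, so their cuts add up to the pairs from [A] to its complement. *)
have total : \sum_(c in S) cut A c = #|A| * (#|Omega| - #|A|).
  have -> : #|Omega| - #|A| = #|~: A| by rewrite [RHS]cardsCs setCK.
  rewrite -cardsX -sum1_card [RHS]big_mkcond /=.
  transitivity (\sum_(z in [set: Omega * Omega]) leaves A z.1 z.2 : nat).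
    rewrite (set_partition_big _ partS) /=; apply: eq_bigr => c _.
    rewrite /cut /weight_sum pair_bigA /= [RHS]big_mkcond /=.
    by apply: eq_bigr => -[x y] _ /=; case: (_ \in c); rewrite ?mul1n.
  rewrite big_mkcond; apply: eq_bigr => -[x y] _.
  by rewrite /leaves !inE /=; case: (_ && _).
have : (\sum_(c in S) cut A c) * #|Omega| <= D * m * #|Omega| ^ 2.
  have -> : #|Omega| ^ 2 = \sum_(c in S) #|c|.
    by rewrite -(card_partition partS) cardsT card_prod.
  by rewrite big_distrl big_distrr /=; apply: leq_sum.
rewrite total.
have [->//|] := posnP #|A|.
move=> A_gt0 h.
have n_gt0 : 0 < #|Omega| by lia.
have h1 : #|A| * (#|Omega| - #|A|) <= D * m * #|Omega|.
  by rewrite -(leq_pmul2r n_gt0); apply: leq_trans h _; rewrite expnS expn1 mulnA.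
rewrite -(leq_pmul2r n_gt0).
(* The complement holds at least half of the points, whence the factor 2 in [D.*2]. *)
have h2 : #|A| * #|Omega| <= #|A| * (#|Omega| - #|A|).*2.
  by rewrite leq_mul2l; apply/orP; right; lia.
lia.
Qed.

(** * Growth of directed balls *)

Fixpoint ball a x r : {set Omega} :=
  if r is r'.+1 then ball a x r' :|: out_nbr a (ball a x r') else [set x].

Lemma ball_walk a x r y : y \in ball a x r ->
  exists p, [/\ path (edge a) x p, last x p = y & size p <= r].
Proof.
elim: r y => [|r IHr] y /=; first by rewrite inE => /eqP->; exists [::].
rewrite !inE => /orP[/IHr[p [xp <- pr]]|/existsP[z /andP[/IHr[p [xp <- pr]] zy]]].
  by exists p; split=> //; apply: leqW.
by exists (rcons p y); rewrite rcons_path xp last_rcons size_rcons.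
Qed.

Lemma leq_ball a x r j : #|ball a x r| <= #|ball a x (r + j)|.
Proof.
elim: j => [|j IHj]; first by rewrite addn0.
by rewrite addnS /=; apply: leq_trans IHj (subset_leq_card (subsetUl _ _)).
Qed.

(** While the ball fills at most half of the points, [expansion] makes each step add at least a
    fraction 1/(2D) of the initial size, so [D.*2] steps double it. *)
Lemma ball_double a D x r : is_union_of S a ->
    (forall y z, exists p, [/\ path (edge (a :|: conv_rel a)) y p,
                               last y p = z & size p <= D]) ->
  #|Omega| < #|ball a x (r + D.*2)|.*2 \/
  #|ball a x r|.*2 <= #|ball a x (r + D.*2)|.
Proof.
move=> ua walks.
have grow j : #|Omega| < #|ball a x (r + j)|.*2 \/
    (D.*2 + j) * #|ball a x r| <= D.*2 * #|ball a x (r + j)|.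
  elim: j => [|j IHj]; first by right; rewrite !addn0.
  rewrite addnS /=; set B := ball a x (r + j) in IHj *.
  have rB : #|ball a x r| <= #|B| by exact: leq_ball.
  clearbody B.
  have -> : #|B :|: out_nbr a B| = #|B| + #|out_nbr a B :\: B|.
    have := subset_leq_card (subsetIr B (out_nbr a B)).
    by rewrite cardsU cardsD setIC; lia.
  have [small|big] := leqP #|B|.*2 #|Omega|; last first.
    by left; apply: leq_trans big _; rewrite leq_double leq_addr.
  have Bexp := expansion ua walks small.
  by case: IHj => [|IHj]; [lia|right; lia].
case: (grow D.*2) => [|le2]; [by left|].
(* For [D = 0] the bound from [grow] is only [0 <= 0], but [expansion] then shows that a ball of at
   most half the points is empty. *)
have [D0|D_gt0] := posnP D; last by right; rewrite -(leq_pmul2l D_gt0); lia.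
have [|small] := ltnP #|Omega| #|ball a x r|.*2; last first.
  by have := expansion ua walks small; rewrite D0; lia.
by rewrite D0 addn0; left.
Qed.

(** From one point, [m] doublings give [2 ^ m] points, a majority because [#|Omega| < 2 ^ m.+1]. *)
Lemma ball_majority a D x : is_union_of S a ->
    (forall y z, exists p, [/\ path (edge (a :|: conv_rel a)) y p,
                               last y p = z & size p <= D]) ->
  #|Omega| < #|ball a x (D.*2 * trunc_log 2 #|Omega|)|.*2.
Proof.
move=> ua walks; set m := trunc_log 2 #|Omega|.
suff : #|Omega| < #|ball a x (D.*2 * m)|.*2 \/ 2 ^ m <= #|ball a x (D.*2 * m)|.
  case=> // le2; apply: leq_trans (trunc_log_ltn _ (isT : 1 < 2)) _.
  by rewrite -/m expnS; lia.
elim: m => [|m IHm]; first by right; rewrite muln0 /= cards1.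
have mono := leq_ball a x (D.*2 * m) D.*2.
rewrite mulnSr expnS.
by case: (ball_double x (D.*2 * m) ua walks) => ?; [left|case: IHm => ?; [left|right]]; lia.
Qed.

Lemma directed_walk a D x y : is_union_of S a ->
    (forall y z, exists p, [/\ path (edge (a :|: conv_rel a)) y p,
                               last y p = z & size p <= D]) ->
  exists p, [/\ path (edge a) x p, last x p = y &
                size p <= 4 * D * trunc_log 2 #|Omega|].
Proof.
move=> ua walks; set m := trunc_log 2 #|Omega|.
(* Balls of [conv_rel a] are in-balls of [a], and both relations have the same symmetrisation. *)
have uac := conv_union ua.
have walksc u v : exists p, [/\ path (edge (conv_rel a :|: conv_rel (conv_rel a))) u p,
    last u p = v & size p <= D] by rewrite conv_relK setUC; exact: walks.
have majx := ball_majority x ua walks.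
have majy := ball_majority y uac walksc.
have /set0Pn[z] : ball a x (D.*2 * m) :&: ball (conv_rel a) y (D.*2 * m) != set0.
  apply/eqP => I0; have := max_card (ball a x (D.*2 * m) :|: ball (conv_rel a) y (D.*2 * m)).
  by rewrite cardsU I0 cards0 -/m in majx majy *; lia.
rewrite inE => /andP[/ball_walk[p [xp pz pm]] /ball_walk[q [yq qz qm]]].
(* [rev (belast y q)] reads the walk [y :: q] backwards from [z] to [y], omitting [z], where [p]
   already ends. *)
exists (p ++ rev (belast y q)); split.
- rewrite cat_path xp pz -qz rev_path /=; apply: sub_path yq => u v.
  by rewrite /edge inE.
- rewrite last_cat pz -qz; case: (q) => //= u s.
  by rewrite rev_cons last_rcons.
- by rewrite size_cat size_rev size_belast; lia.
Qed.
End InScheme.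
End Cuts.

(** * Extended-real distances and the final bound *)

Local Open Scope ring_scope.

Lemma dist_le (R : realType) (Omega : finType) (a : {set Omega * Omega}) x p :
  path (edge a) x p -> (dist R a x (last x p) <= (size p)%:R%:E)%E.
Proof. by move=> xp; apply: ereal_inf_lbound; exists p. Qed.

Lemma dist_ge (R : realType) (Omega : finType) (a : {set Omega * Omega}) x y m :
    (forall p, path (edge a) x p -> last x p = y -> (m <= size p)%N) ->
  (m%:R%:E <= dist R a x y)%E.
Proof.
by move=> mle; apply: le_ereal_inf_tmp => _ [p [xp py] <-]; rewrite lee_fin ler_nat mle.
Qed.

Lemma le_ddiam (R : realType) (Omega : finType) (a : {set Omega * Omega}) x y :
  (dist R a x y <= ddiam R a)%E.
Proof. exact: (le_bigmax 0%E (fun z => dist R a z.1 z.2) (x, y)). Qed.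

(** Replaces the diameter by a natural number: connectedness provides shortest walks, and the
    largest of their lengths serves as [D]. *)
Lemma short_walks (R : realType) (Omega : finType) (a : {set Omega * Omega}) :
    (forall x y, connect (edge a) x y) ->
  exists2 D : nat, (D%:R%:E <= ddiam R a)%E &
    forall x y, exists p, [/\ path (edge a) x p, last x p = y & (size p <= D)%N].
Proof.
move=> conn.
have ex x y : exists m, [exists p : m.-tuple Omega,
    path (edge a) x p && (last x p == y)].
  have /connectP[p xp ->] := conn x y.
  by exists (size p); apply/existsP; exists (in_tuple p); rewrite xp eqxx.
pose d z := ex_minn (ex z.1 z.2).
have dP x y : (exists p, [/\ path (edge a) x p, last x p = y & size p = d (x, y)])
    /\ (forall p, path (edge a) x p -> last x p = y -> (d (x, y) <= size p)%N).
  rewrite /d; case: ex_minnP => m /existsP[p /andP[xp /eqP py]] minm; split.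
    by exists p; rewrite size_tuple.
  by move=> q xq qy; apply: minm; apply/existsP; exists (in_tuple q); rewrite xq qy eqxx.
exists (\max_z d z)%N; last first.
  by move=> x y; have [[p [xp py pd]] _] := dP x y; exists p; split=> //; rewrite pd leq_bigmax.
have [/card0_eq O0|O_gt0] := posnP #|{: Omega * Omega}|.
  rewrite big_pred0 => [|z]; last by have := O0 z; rewrite inE.
  by rewrite /ddiam big_pred0 // => z; have := O0 z; rewrite inE.
have [[x y] ->] := bigop.eq_bigmax d O_gt0.
by apply: le_trans (le_ddiam R a x y); apply: dist_ge; case: (dP x y).
Qed.

Lemma trunc_log_le_log2 (R : realType) (n : nat) :
  (0 < n)%N -> (trunc_log 2 n)%:R <= log2 (n%:R : R).
Proof.
move=> n_gt0; have ln2_gt0 : 0 < ln 2 :> R by rewrite ln_gt0 // ltr1n.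
rewrite /log2 ler_pdivlMr // mulr_natl -lnXn // ler_ln ?posrE ?exprn_gt0 ?ltr0n //.
by rewrite -natrX ler_nat trunc_logP.
Qed.

Theorem theorem4p1 (R : realType) :
  exists2 C : R, 0 < C &
    forall (Omega : finType) (S : {set {set Omega * Omega}})
           (a : {set Omega * Omega}),
      is_scheme S -> is_union_of S a -> connected_rel a ->
      (ddiam R a <= C%:E * diam R a ^+ 2 * (log2 (#|Omega|%:R : R) ^+ 2)%:E)%E.
Proof.
(* The constant is that of [directed_walk]: two balls of radius [D.*2 * m]. *)
exists 4 => [|Omega S a schS ua conn]; first exact: ltr0n.
have [D Dle walks] := short_walks R conn.
set m := trunc_log 2 #|Omega|.
have ddiam_le : (ddiam R a <= (4 * D ^ 2 * m ^ 2)%:R%:E)%E.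
  apply: bigmax_le => [|[x y] _ /=]; first by rewrite lee_fin ler0n.
  have [p [xp <- pm]] := directed_walk schS x y ua walks.
  apply: le_trans (dist_le R xp) _; rewrite lee_fin ler_nat.
  apply: leq_trans pm _; rewrite -/m.
  (* The bound linear in [D] and [m] is weakened to the squares while still in the naturals, where
     this is always valid. *)
  have le_sq k : (k <= k ^ 2)%N by case: k => // k; rewrite -mulnn leq_pmulr.
  by rewrite !leq_mul.
have O_gt0 := scheme_points_gt0 schS.
apply: le_trans ddiam_le _.
have -> : ((4 * D ^ 2 * m ^ 2)%:R%:E = 4%:E * D%:R%:E ^+ 2 * (m%:R ^+ 2)%:E :> \bar R)%E.
  by rewrite 2!natrM 2!natrX -EFin_expe -!EFinM.
have m_le := trunc_log_le_log2 R O_gt0.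
have D2_ge0 : (0 <= D%:R%:E ^+ 2 :> \bar R)%E by rewrite expe_ge0 // lee_fin.
apply: lee_pmul.
- by rewrite mule_ge0 // lee_fin.
- by rewrite lee_fin exprn_ge0.
- by apply: lee_pmul; rewrite ?lee_fin // !expe2 lee_pmul // lee_fin.
- by rewrite lee_fin lerXn2r // nnegrE ?(le_trans _ m_le).
Qed.
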